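(* Let $\Sigma=\{\mathcal I_j,\mathcal L_j,\mathcal V_k : j=0,\dots,d,\ k=1,\dots,\tilde d\}$ be the set of linear functionals, and $A,G,C,\tilde C,M$ the matrices, defined in the context. Then $\Sigma$ is unisolvent on $\mathbb P_2(S_d)$ if and only if both of the following hold: (a) the matrix $A$ is invertible; (b) the Schur complement $T=M-\tilde C G^{-1}C\in\mathbb R^{(d+1)\times(d+1)}$ is invertible.
   Context: Let $d\ge 2$ and let $S_d\subset\mathbb R^d$ be a nondegenerate $d$-simplex with vertices $\boldsymbol v_0,\dots,\boldsymbol v_d$ and barycentric coordinates $\lambda_0,\dots,\lambda_d$. $F_j$ is the face opposite $\boldsymbol v_j$. $\mathbb P_k(X)$ is the space of (restrictions to $X$ of) polynomials of total degree at most $k$. $\Omega\in L^1(S_d)$ is a probability density, strictly positive a.e. in the interior of $S_d$. For each $j$, the induced face density $\omega_j$ is the normalized conditional trace of $\Omega$ on $F_j$: for every $\phi$ continuous on $F_j$ (extended continuously to $S_d$), $$\int_{F_j}\phi\,\omega_j\,d\boldsymbol x=\lim_{\varepsilon\to0^+}\frac{\int_{\{\lambda_j<\varepsilon\}}\phi\,\Omega\,d\boldsymbol\sigma}{\int_{\{\lambda_j<\varepsilon\}}\Omega\,d\boldsymbol\sigma};$$ it is assumed that this limit exists and defines a probability density $\omega_j\in L^1(F_j)$, positive a.e. on $F_j$ (with respect to $(d-1)$-dimensional Lebesgue measure). Set $\langle f,g\rangle_\Omega=\int_{S_d}fg\,\Omega\,d\boldsymbol\sigma$ and $\langle f,g\rangle_{\omega_j}=\int_{F_j}fg\,\omega_j\,d\boldsymbol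 x$ (functions on $S_d$ are restricted to $F_j$). $\mathbb S_2(S_d)=\{p\in\mathbb P_2(S_d):\langle p,\varphi\rangle_\Omega=0\ \forall\varphi\in\mathbb P_1(S_d)\}$, of dimension $d(d+1)/2$. Let $\tilde d=(d-2)(d+1)/2$. Let $\rho_1,\dots,\rho_{\tilde d}\in\mathbb S_2(S_d)$ be linearly independent, $\mathbb V=\operatorname{span}\{\rho_k\}$, and let $\psi_0,\dots,\psi_d\in\mathbb S_2(S_d)$, $\mathbb W=\operatorname{span}\{\psi_j\}$, be such that $\mathbb S_2(S_d)=\mathbb V\oplus\mathbb W$ (direct sum, not necessarily orthogonal, so $\psi_0,\dots,\psi_d$ is a basis of $\mathbb W$). For each $j$ let $q_j\in\mathbb P_2(F_j)$ satisfy $\langle q_j,\varphi\rangle_{\omega_j}=0$ for all $\varphi\in\mathbb P_1(F_j)$. Functionals: $\mathcal I_j(f)=\langle f,1\rangle_{\omega_j}$, $\mathcal L_j(f)=\langle f,q_j\rangle_{\omega_j}$ ($j=0,\dots,d$), $\mathcal V_k(f)=\langle f,\rho_k\rangle_\Omega$ ($k=1,\dots,\tilde d$). Their number is $\dim\mathbb P_2(S_d)$; ''$\Sigma$ is unisolvent on $\mathbb P_2(S_d)$'' means that the only $p\in\mathbb P_2(S_d)$ annihilated by all functionals in $\Sigma$ is $p=0$. Matrices: $[A]_{ji}=\mathcal I_j(\lambda_i)$, $[G]_{k\ell}=\mathcal V_k(\rho_\ell)$ (a Gram matrix, hence symmetric positive definite), $[C]_{ki}=\mathcal V_k(\psi_i)$,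 $[\tilde C]_{j\ell}=\mathcal L_j(\rho_\ell)$, $[M]_{ji}=\mathcal L_j(\psi_i)$, with $i,j=0,\dots,d$ and $k,\ell=1,\dots,\tilde d$. If $d=2$ then $\tilde d=0$, the blocks $G,C,\tilde C$ are empty and $T=M$. *)

(* Defs.v *)
From HB Require Import structures.
From mathcomp Require Import all_boot all_order all_algebra.
From mathcomp Require Import all_classical all_reals all_analysis.
From mathcomp Require Import measurable_realfun.
(* The notations of [mpoly] clash with those of MathComp-Analysis, so only its
   canonical structures and coercions are imported. *)
From mathcomp.multinomials Require Import(canonicals, coercions) mpoly.

Set Implicit Arguments.
Unset Strict Implicit.
Unset Printing Implicit Defensive.

Import Order.TTheory GRing.Theory Num.Theory.
Import numFieldNormedType.Exports.

Local Open Scope classical_set_scope.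
Local Open Scope ring_scope.

(* MathComp-Analysis equips matrices with the product topology but with no
   sigma-algebra: we use the one generated by the entries. On [R^n] (row vectors
   over a [realType]) it is the Borel sigma-algebra. *)
Definition measure_mx_display : measure_display -> measure_display.
Proof. exact. Qed.

Section measurable_matrix.
Context {d} {T : measurableType d}.
Variables m n : nat.

Definition mx_cylinder : set (set 'M[T]_(m, n)) :=
  [set A | exists i j, exists2 B : set T, measurable B &
             A = [set M : 'M[T]_(m, n) | B (M i j)]].

Let mx_set0 : <<s mx_cylinder >> set0.
Proof. exact: sigma_algebra0. Qed.

Let mx_setC A : <<s mx_cylinder >> A -> <<s mx_cylinder >> (~` A).
Proof. exact: sigma_algebraC. Qed.

Let mx_bigcup (F : (set 'M[T]_(m, n))^nat) :
  (forall i, <<s mx_cylinder >> (F i)) -> <<s mx_cylinder >> (\bigcup_i F i).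
Proof. exact: sigma_algebra_bigcup. Qed.

HB.instance Definition _ := @isMeasurable.Build (measure_mx_display d)
  'M[T]_(m, n) <<s mx_cylinder >> mx_set0 mx_setC mx_bigcup.

End measurable_matrix.

Lemma measurable_entry d (T : measurableType d) m n (i : 'I_m) (j : 'I_n) :
  measurable_fun [set: 'M[T]_(m, n)] (fun M : 'M[T]_(m, n) => M i j).
Proof.
move=> _ B mB; rewrite setTI.
by apply: sub_sigma_algebra; exists i, j; exists B.
Qed.

Lemma measurable_fun_mx d d' (T : measurableType d) (T' : measurableType d')
    m n (f : T' -> 'M[T]_(m, n)) :
  (forall i j, measurable_fun [set: T'] (fun x => f x i j)) ->
  measurable_fun [set: T'] f.
Proof.
move=> mf; apply: (measurability (@mx_cylinder _ T m n)) => //.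
move=> _ [_ [i [j [B mB ->]] <-]]; exact: mf.
Qed.

Section lebesgue_rV.
Context {R : realType}.
Local Open Scope ereal_scope.

Definition cons_rV n (p : R * 'rV[R]_n) : 'rV[R]_n.+1 :=
  \row_j (if unlift ord0 j is Some k then p.2 ord0 k else p.1).

(* Lebesgue measure on [R^n]: the [n]-fold product of the Lebesgue measure on
   the line. *)
Fixpoint lebesgue_rV n : set 'rV[R]_n -> \bar R :=
  match n with
  | 0 => \d_ (0%R : 'rV[R]_0)
  | n'.+1 => pushforward (lebesgue_measure \x lebesgue_rV (n := n'))
                         (@cons_rV n')
  end.

Definition uncons_rV n (x : 'rV[R]_n.+1) : R * 'rV[R]_n :=
  (x ord0 ord0, \row_k x ord0 (lift ord0 k)).

Lemma cons_rVK n : cancel (@cons_rV n) (@uncons_rV n).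
Proof.
move=> [a x]; rewrite /uncons_rV mxE unlift_none; congr pair.
by apply/rowP => k; rewrite !mxE liftK.
Qed.

Lemma uncons_rVK n : cancel (@uncons_rV n) (@cons_rV n).
Proof.
by move=> x; apply/rowP => j; rewrite mxE; case: unliftP => [k|] ->; rewrite ?mxE.
Qed.

Lemma measurable_cons_rV n : measurable_fun [set: R * 'rV[R]_n] (@cons_rV n).
Proof.
apply: measurable_fun_mx => i j; under eq_fun do rewrite mxE.
case: (unlift ord0 j) => [k|]; last exact: measurable_fst.
apply: (@measurableT_comp _ _ _ _ _ _ (fun x : 'rV[R]_n => x ord0 k) _ snd).
  exact: measurable_entry.
exact: measurable_snd.
Qed.

Lemma measurable_uncons_rV n :
  measurable_fun [set: 'rV[R]_n.+1] (@uncons_rV n).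
Proof.
apply: measurable_fun_pair; first exact: measurable_entry.
apply: measurable_fun_mx => i k; under eq_fun do rewrite mxE.
exact: measurable_entry.
Qed.

Lemma sigma_finite_cons_rV n (mu : {sigma_finite_measure set 'rV[R]_n -> \bar R}) :
  sigma_finite [set: 'rV[R]_n.+1]
    (pushforward (lebesgue_measure \x mu) (@cons_rV n)).
Proof.
have /sigma_finiteP[F [FT ndF Foo]] := sigma_finiteT (@lebesgue_measure R).
have /sigma_finiteP[G [GT ndG Goo]] := sigma_finiteT mu.
exists (fun k => @uncons_rV n @^-1` (F k `*` G k)).
  rewrite -preimage_bigcup (_ : \bigcup_i _ = setT) ?preimage_setT//.
  rewrite -setXTT FT GT predeqE => -[x y]; split.
    by move=> [k _ []/= ? ?]; split; exists k.
  move=> [/= [k _ Fkx] [l _ Gly]]; exists (maxn k l) => //; split.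
    by move: x Fkx; exact/subsetPset/ndF/leq_maxl.
  by move: y Gly; exact/subsetPset/ndG/leq_maxr.
move=> k; have [mF Fk] := Foo k; have [mG Gk] := Goo k; split.
  rewrite -[X in measurable X]setTI.
  by apply: measurable_uncons_rV => //; exact: measurableX.
rewrite /pushforward -comp_preimage.
rewrite (_ : _ \o _ = idfun) ?preimage_id; last first.
  by apply/funext => x /=; rewrite cons_rVK.
by rewrite product_measure1E// lte_mul_pinfty// ge0_fin_numE.
Qed.

Fact lebesgue_rV_sigma_finite_measure n :
  exists mu : {sigma_finite_measure set 'rV[R]_n -> \bar R},
    @lebesgue_rV n = mu.
Proof.
elim: n => [|n [mu muE]]; first by exists (\d_ (0%R : 'rV[R]_0)).
rewrite /= muE.
have mc : measurable_fun [set: (measurableTypeR R * 'rV[R]_n)%type] (@cons_rV n).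
  exact: measurable_cons_rV.
have [m nuE] : exists m : {measure set 'rV[R]_n.+1 -> \bar R},
    pushforward (lebesgue_measure \x mu) (@cons_rV n) = m.
  by exists (measure_function_pushforward__canonical__measure_function_Measure
    (lebesgue_measure \x mu) mc).
have sf : sigma_finite setT m by rewrite -nuE; exact: sigma_finite_cons_rV.
pose H1 := isSFinite.Build _ _ _ _ (sfinite_measure_sigma_finite sf).
pose H2 := isSigmaFinite.Build _ _ _ _ sf.
by exists (HB.pack_for {sigma_finite_measure set 'rV[R]_n.+1 -> \bar R}
  (Measure.sort m) H1 H2).
Qed.

Let lebesgue_rV0 n : @lebesgue_rV n set0 = 0.
Proof. by have [mu ->] := lebesgue_rV_sigma_finite_measure n; exact: measure0. Qed.

Let lebesgue_rV_ge0 n A : 0 <= @lebesgue_rV n A.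
Proof. by have [mu ->] := lebesgue_rV_sigma_finite_measure n; exact: measure_ge0. Qed.

Let lebesgue_rV_sigma_additive n : semi_sigma_additive (@lebesgue_rV n).
Proof.
have [mu ->] := lebesgue_rV_sigma_finite_measure n.
exact: measure_semi_sigma_additive.
Qed.

HB.instance Definition _ n := isMeasure.Build _ _ _ (@lebesgue_rV n)
  (@lebesgue_rV0 n) (@lebesgue_rV_ge0 n) (@lebesgue_rV_sigma_additive n).

Let lebesgue_rV_sigma_finite n : sigma_finite setT (@lebesgue_rV n).
Proof.
by have [mu ->] := lebesgue_rV_sigma_finite_measure n; exact: sigma_finiteT.
Qed.

HB.instance Definition _ n := Measure_isSigmaFinite.Build _ _ _
  (@lebesgue_rV n) (@lebesgue_rV_sigma_finite n).

End lebesgue_rV.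
Arguments lebesgue_rV R n : clear implicits.

Lemma lebesgue_rV_box (R : realType) n (B : 'I_n -> set R) :
  (forall i, measurable (B i)) ->
  lebesgue_rV R n [set x : 'rV[R]_n | forall i, B i (x ord0 i)] =
  (\prod_(i < n) lebesgue_measure (B i : set (measurableTypeR R)))%E.
Proof.
elim: n B => [|n IH] B mB.
  have -> : [set x : 'rV[R]_0 | forall i, B i (x ord0 i)] = setT.
    by apply/seteqP; split=> // x _ [].
  by rewrite big_ord0 /= diracT.
rewrite big_ord_recl -IH//.
have [mu muE] := lebesgue_rV_sigma_finite_measure (R := R) n.
rewrite /= muE /pushforward.
rewrite (_ : _ @^-1` _ = B ord0 `*`
    [set x : 'rV[R]_n | forall i, B (lift ord0 i) (x ord0 i)]); last first.
  apply/seteqP; split=> -[a x]/=.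
    move=> H; split; first by have := H ord0; rewrite mxE unlift_none.
    by move=> i; have := H (lift ord0 i); rewrite mxE liftK.
  by move=> [Ba Bx] i; rewrite mxE; case: unliftP => [j|] -> /=.
rewrite product_measure1E//; first exact: mB.
rewrite [X in measurable X](_ : _ = \bigcap_i
    [set x : 'rV[R]_n | B (lift ord0 i) (x ord0 i)]); last first.
  by apply/seteqP; split=> x /= H i; [move=> _; exact: H|exact: H].
apply: fin_bigcap_measurable => [|i _]; first exact: finite_finset.
rewrite -[X in measurable X]setTI.
exact: (measurable_entry (T := R) (n := n) (ord0 : 'I_1) i).
Qed.

Section affine.
Context {R : realType}.
Variables m d : nat.
Implicit Types (w : 'I_m.+1 -> 'rV[R]_d).

Definition edge_mx w : 'M[R]_(m, d) :=
  \matrix_(k < m) (w (lift ord0 k) - w ord0).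

Definition affine_param w (t : 'rV[R]_m) : 'rV[R]_d :=
  w ord0 + t *m edge_mx w.

Lemma measurable_affine_param w : measurable_fun [set: 'rV[R]_m] (affine_param w).
Proof.
apply: measurable_fun_mx => i j; rewrite /affine_param.
under eq_fun do rewrite mxE mxE.
apply: measurable_funD => //; apply: measurable_sum => k.
by apply: measurable_funM => //; exact: measurable_entry.
Qed.

(* [m]-dimensional Lebesgue measure on the affine hull of [m + 1] points of
   [R^d]: the image of Lebesgue measure on [R^m] under [affine_param w], times
   its Jacobian, the square root of the Gram determinant of the edges. *)
Definition flat_measure w : set 'rV[R]_d -> \bar R :=
  pushforward
    (mscale (NngNum (sqrtr_ge0 (\det (edge_mx w *m (edge_mx w)^T))))
            (lebesgue_rV R m))
    (affine_param w).

HB.instance Definition _ w := Measure.copy (flat_measure w)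
  (measure_function_pushforward__canonical__measure_function_Measure
    (mscale (NngNum (sqrtr_ge0 (\det (edge_mx w *m (edge_mx w)^T))))
            (lebesgue_rV R m))
    (measurable_affine_param w)).

End affine.

Section simplex.
Context {R : realType} {d : nat}.
Variable v : 'I_d.+1 -> 'rV[R]_d.

Definition nondegenerate_simplex := row_free (edge_mx v).

Definition simplex : set 'rV[R]_d :=
  [set x | exists t : 'I_d.+1 -> R,
     [/\ forall i, 0 <= t i, \sum_i t i = 1 & x = \sum_i t i *: v i]].

Definition face (j : 'I_d.+1) : set 'rV[R]_d :=
  [set x | exists t : 'I_d.+1 -> R,
     [/\ forall i, 0 <= t i, t j = 0, \sum_i t i = 1 & x = \sum_i t i *: v i]].

(* Coordinates [t] of [x - v_0] in the basis of edges [v_k - v_0], completed by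
   [1 - \sum_k t_k] at the vertex [v_0]; see [bary_sum1], [bary_comb] and
   [bary_uniq]. *)
Definition bary (i : 'I_d.+1) (x : 'rV[R]_d) : R :=
  let t := (x - v ord0) *m invmx (edge_mx v) in
  if unlift ord0 i is Some k then t ord0 k else 1 - \sum_k t ord0 k.

Lemma bary_sum1 x : \sum_i bary i x = 1.
Proof.
rewrite big_ord_recl /bary unlift_none.
by under [X in _ + X]eq_bigr do rewrite liftK; rewrite subrK.
Qed.

Lemma comb_edge (t : 'I_d.+1 -> R) : \sum_i t i = 1 ->
  \sum_i t i *: v i = v ord0 + (\row_k t (lift ord0 k)) *m edge_mx v.
Proof.
move=> t1; rewrite big_ord_recl.
have -> : t ord0 = 1 - \sum_k t (lift ord0 k) by rewrite -t1 big_ord_recl addrK.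
rewrite scalerBl scale1r -addrA; congr (_ + _).
rewrite mulmx_sum_row scaler_suml -sumrN -big_split/=.
by apply: eq_bigr => k _; rewrite mxE rowK scalerBr addrC.
Qed.

Lemma bary_comb x : nondegenerate_simplex -> \sum_i bary i x *: v i = x.
Proof.
rewrite /nondegenerate_simplex row_free_unit => vu.
rewrite (comb_edge (bary_sum1 x)).
rewrite (_ : \row_k _ = (x - v ord0) *m invmx (edge_mx v)).
  by rewrite mulmxKV// addrC subrK.
by apply/rowP => k; rewrite !mxE /bary liftK mxE.
Qed.

Lemma bary_uniq x (t : 'I_d.+1 -> R) : nondegenerate_simplex ->
  \sum_i t i = 1 -> \sum_i t i *: v i = x -> forall i, t i = bary i x.
Proof.
rewrite /nondegenerate_simplex row_free_unit => vu t1 tx i.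
have tE : (x - v ord0) *m invmx (edge_mx v) = \row_k t (lift ord0 k).
  by rewrite -tx comb_edge// addrC addKr mulmxK.
rewrite /bary tE; case: unliftP => [k|] ->; first by rewrite mxE.
by under eq_bigr do rewrite mxE; rewrite -t1 big_ord_recl addrK.
Qed.

(* The vertices other than [v_j], in increasing order of index; there are [d] of
   them when [0 < d], and [inord] avoids a cast along [d.-1.+1 = d]. *)
Definition face_vertices (j : 'I_d.+1) (k : 'I_d.-1.+1) : 'rV[R]_d :=
  v (inord (bump j k)).

Definition face_measure (j : 'I_d.+1) : set 'rV[R]_d -> \bar R :=
  flat_measure (face_vertices j).

HB.instance Definition _ j :=
  Measure.copy (face_measure j) (flat_measure (face_vertices j)).

End simplex.

Section densities.
Context {R : realType} {d : nat}.
Implicit Types (mu : {measure set 'rV[R]_d -> \bar R}) (X : set 'rV[R]_d).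
Implicit Types (w f g : 'rV[R]_d -> R) (v : 'I_d.+1 -> 'rV[R]_d).

Definition prob_density mu X w :=
  [/\ mu.-integrable X (EFin \o w),
      {ae mu, forall x, X x -> 0 <= w x} &
      \int[mu]_(x in X) w x = 1].

Definition inner mu X w f g : R := \int[mu]_(x in X) (f x * g x * w x).

Definition collar v (j : 'I_d.+1) (e : R) : set 'rV[R]_d :=
  [set x | simplex v x /\ bary v j x < e].

(* A continuous function on the simplex is the same thing as a continuous
   function on the face together with a continuous extension of it. *)
Definition conditional_trace v (Omega : 'rV[R]_d -> R) (j : 'I_d.+1) w :=
  forall phi : 'rV[R]_d -> R, {within simplex v, continuous phi} ->
    (\int[lebesgue_rV R d]_(x in collar v j e) (phi x * Omega x)) /
      (\int[lebesgue_rV R d]_(x in collar v j e) Omega x) @[e --> 0^'+]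
    --> \int[face_measure v j]_(x in face v j) (phi x * w x).

(* Restrictions to [X] are extended by zero outside [X], so that equality of
   functions on [X] is equality in [poly_space k X]. *)
Definition poly_space (k : nat) X : set ('rV[R]_d -> R) :=
  [set f | exists2 p : mpoly.mpoly d R, (mpoly.msize p <= k.+1)%N &
             f = patch (fun=> 0) X (fun x => mpoly.meval (x ord0) p)].

Definition orth_quadratics mu X w : set ('rV[R]_d -> R) :=
  [set p | poly_space 2 X p /\
           forall phi, poly_space 1 X phi -> inner mu X w p phi = 0].

End densities.

Definition unisolvent (T : Type) (R : realType) (P : set (T -> R))
    (Sigma : set ((T -> R) -> R)) :=
  forall p, P p -> (forall l, Sigma l -> l p = 0) -> p = (fun=> 0).

Definition lin_indep (R : realType) (V : lmodType R) n (f : 'I_n -> V) :=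
  forall c : 'I_n -> R, \sum_i c i *: f i = 0 -> forall i, c i = 0.

Definition lin_span (R : realType) (V : lmodType R) n (f : 'I_n -> V) : set V :=
  [set u | exists c : 'I_n -> R, u = \sum_i c i *: f i].

Definition direct_sum (V : zmodType) (U V1 V2 : set V) :=
  U = [set x + y | x in V1 & y in V2] /\ V1 `&` V2 = [set 0].

Definition dtilde (d : nat) : nat := ((d - 2) * d.+1)./2.

(* Main.v *)
(* By positive definiteness of the inner product, P_2 is the orthogonal sum of
   P_1 (spanned by the barycentric coordinates) and S_2. Orthogonality makes
   L_j and V_k vanish on P_1, so in the basis (lambda, rho, psi) the matrix of
   the functionals (I, V, L) is block triangular, with diagonal blocks A and
   [G C; Ct M]; as the Gram matrix G is invertible, the latter is invertible
   exactly when its Schur complement T is. That rho and psi together form a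
   basis of S_2 is a dimension count: the d(d+1)/2 products
   lambda_i lambda_j, i < j, are linearly independent modulo P_1, as one sees
   by evaluating at the vertices and at the midpoints of the edges. *)
Require Import Defs.
From mathcomp Require Import all_boot all_order all_algebra.
From mathcomp Require Import all_classical all_reals all_analysis.
From mathcomp Require Import measurable_realfun.
From mathcomp.multinomials Require Import(canonicals, coercions) mpoly.

Set Implicit Arguments.
Unset Strict Implicit.
Unset Printing Implicit Defensive.

Import Order.TTheory GRing.Theory Num.Theory.
Import numFieldNormedType.Exports.

Local Open Scope classical_set_scope.
Local Open Scope ring_scope.

(** * Linear algebra: trivial kernels, block elimination, changes of family *)

Lemma unitmx_ker0 (F : fieldType) n (A : 'M[F]_n) :
  (A \in unitmx) <-> (forall c : 'cV_n, A *m c = 0 -> c = 0).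
Proof.
split=> [Au c Ac0|A_inj]; first by rewrite -[c](mulKmx Au) Ac0 mulmx0.
rewrite -unitmx_tr -row_free_unit -kermx_eq0; apply/eqP/row_matrixP => i.
rewrite row0; apply: (can_inj (@trmxK _ _ _)); rewrite trmx0; apply: A_inj.
by apply: (can_inj (@trmxK _ _ _));
  rewrite trmx_mul trmxK -row_mul mulmx_ker row0 trmx0.
Qed.

(** Block elimination: the last equation forces [a = - G^-1 C c], which turns the middle one into
    [T c = 0] for the Schur complement T; once [a] and [c] vanish, the first one reads [A b = 0].
    Conversely, vectors with [a = c = 0] test A, and any [c] killed by T extends to a solution of
    the system by solving for [a], then for [b]. *)
Lemma block_triangular_ker0 (F : fieldType) n m (A X2 M : 'M[F]_n)
    (X1 Ct : 'M[F]_(n, m)) (C : 'M[F]_(m, n)) (G : 'M[F]_m) :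
  G \in unitmx ->
  (forall (b c : 'cV_n) (a : 'cV_m),
     A *m b + X1 *m a + X2 *m c = 0 -> Ct *m a + M *m c = 0 ->
     G *m a + C *m c = 0 -> [/\ b = 0, a = 0 & c = 0]) <->
  A \in unitmx /\ M - Ct *m invmx G *m C \in unitmx.
Proof.
move=> Gu; split=> [ker0|[Au /unitmx_ker0 Tinj] b c a Ab La Ga].
  have Au : A \in unitmx.
    apply/unitmx_ker0 => b Ab0.
    by have [] := ker0 b 0 0; rewrite ?mulmx0 ?addr0.
  split=> //; apply/unitmx_ker0 => c Tc0; pose a := - (invmx G *m (C *m c)).
  by have [] := ker0 (- (invmx A *m (X1 *m a + X2 *m c))) c a;
    rewrite // ?mulmxN ?mulKVmx -?addrA ?addNr//
      -Tc0 mulmxBl addrC !mulmxA.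
have aE : a = - (invmx G *m (C *m c)).
  by apply: (can_inj (mulKmx Gu)); rewrite mulmxN mulKVmx//; apply/eqP;
    rewrite -addr_eq0; exact/eqP.
have c0 : c = 0.
  by apply: Tinj; rewrite mulmxBl addrC -!mulmxA -mulmxN -aE.
have a0 : a = 0 by rewrite aE c0 !mulmx0 oppr0.
by split=> //; move/unitmx_ker0: Au; apply; rewrite -Ab a0 c0 !mulmx0 !addr0.
Qed.

(** The matrix [Y] of coefficients of [u] in terms of [w] is square, and independence of [u] makes
    it invertible. A relation [c] between the [w] is therefore of the form [b Y], where [b] is a
    relation between the [u], hence zero. *)
Lemma lin_indep_of_span (R : realType) (V : lmodType R) n (u w : 'I_n -> V) :
  lin_indep u -> (forall i, lin_span w (u i)) -> lin_indep w.
Proof.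
move=> ui /choice[X uE] c cw0.
pose Y : 'M[R]_n := \matrix_(i, j) X i j.
have Yu : Y \in unitmx.
  rewrite -unitmx_tr; apply/unitmx_ker0 => b Yb0; apply/colP => i; rewrite mxE.
  apply: (ui (fun i => b i ord0)).
  under eq_bigr do rewrite uE scaler_sumr.
  rewrite exchange_big/= big1// => j _.
  under eq_bigr do rewrite scalerA.
  rewrite -scaler_suml; move/matrixP/(_ j ord0) : Yb0; rewrite !mxE => Yb0.
  rewrite (_ : \sum_i _ = 0) ?scale0r// -[RHS]Yb0.
  by apply: eq_bigr => k _; rewrite !mxE mulrC.
pose b : 'rV[R]_n := (\row_j c j) *m invmx Y.
have bY j : c j = \sum_i b ord0 i * X i j.
  have /rowP/(_ j) : \row_j c j = b *m Y by rewrite mulmxKV.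
  by rewrite !mxE => ->; apply: eq_bigr => i _; rewrite [Y _ _]mxE.
have b0 : b = 0.
  apply/rowP => i; rewrite [RHS]mxE; apply: (ui (b ord0)); rewrite -[RHS]cw0.
  under eq_bigr do rewrite uE scaler_sumr.
  rewrite exchange_big; apply: eq_bigr => j _.
  by rewrite bY scaler_suml; apply: eq_bigr => k _; rewrite scalerA.
by move=> j; rewrite bY big1// => i _; rewrite b0 mxE mul0r.
Qed.

(** * Polynomial functions on a subset of R^d *)

Section polynomials.
Context {R : realType} {d : nat}.
Implicit Types (p : mpoly.mpoly d R) (X Y : set 'rV[R]_d).
Implicit Types (f g : 'rV[R]_d -> R).

Lemma poly_spaceP k X f : poly_space k X f <->
  (forall x, ~ X x -> f x = 0) /\
  exists2 p, (mpoly.msize p <= k.+1)%N &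
    forall x, X x -> f x = mpoly.meval (x ord0) p.
Proof.
split=> [[p pk ->]|[f0 [p pk fp]]].
  split=> [x nX|]; first by rewrite patchN//; apply/negP; rewrite inE.
  by exists p => // x Xx; rewrite patchT// inE.
exists p => //; apply/funext => x; have [Xx|nXx] := pselect (X x).
  by rewrite patchT ?inE// fp.
by rewrite patchN ?f0//; apply/negP; rewrite inE.
Qed.

Lemma poly_space_out k X f x : poly_space k X f -> ~ X x -> f x = 0.
Proof. by move=> /poly_spaceP[+ _]; exact. Qed.

Lemma poly_space_le k l X f :
  (k <= l)%N -> poly_space k X f -> poly_space l X f.
Proof. by move=> kl [p pk ->]; exists p => //; rewrite (leq_trans pk). Qed.

Lemma poly_space0 k X : poly_space k X 0.
Proof.
apply/poly_spaceP; split=> //; exists 0; first by rewrite mpoly.msize0.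
by move=> x _; rewrite mpoly.meval0.
Qed.

Lemma poly_spaceD k X f g :
  poly_space k X f -> poly_space k X g -> poly_space k X (f + g).
Proof.
move=> /poly_spaceP[f0 [p pk fp]] /poly_spaceP[g0 [q qk gq]].
apply/poly_spaceP; split=> [x nX|].
  by rewrite -[LHS]/(f x + g x) f0// g0// addr0.
exists (p + q); first by rewrite (leq_trans (mpoly.msizeD_le _ _))// geq_max pk.
by move=> x Xx; rewrite mpoly.mevalD -fp// -gq.
Qed.

Lemma poly_spaceZ k X a f : poly_space k X f -> poly_space k X (a *: f).
Proof.
move=> /poly_spaceP[f0 [p pk fp]]; apply/poly_spaceP; split=> [x nX|].
  by rewrite -[LHS]/(a * f x) f0// mulr0.
exists (a *: p); first by rewrite (leq_trans (mpoly.msizeZ_le _ _)).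
by move=> x Xx; rewrite mpoly.mevalZ -fp.
Qed.

Lemma poly_space_sum k X (I : finType) (c : I -> R) (f : I -> 'rV[R]_d -> R) :
  (forall i, poly_space k X (f i)) -> poly_space k X (\sum_i c i *: f i).
Proof.
move=> fk; apply: (big_ind (poly_space k X)); first exact: poly_space0.
- exact: poly_spaceD.
- by move=> i _; exact: poly_spaceZ.
Qed.

Lemma poly_spaceM k l X f g : poly_space k X f -> poly_space l X g ->
  poly_space (k + l) X (fun x => f x * g x).
Proof.
move=> /poly_spaceP[f0 [p pk fp]] /poly_spaceP[g0 [q ql gq]].
apply/poly_spaceP; split=> [x nX|]; first by rewrite f0// mul0r.
exists (p * q); last by move=> x Xx; rewrite mpoly.mevalM -fp// -gq.
(* [msize] is the degree plus one on nonzero polynomials and 0 at 0, so the product formula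
   [msize p + msize q - 1] requires both factors to be nonzero. *)
have [->|p0] := eqVneq p 0; first by rewrite mul0r mpoly.msize0.
have [->|q0] := eqVneq q 0; first by rewrite mulr0 mpoly.msize0.
rewrite mpoly.msizeM// -ltnS prednK ?addn_gt0 ?lt0n ?mpoly.msize_poly_eq0 ?p0//.
by rewrite (leq_trans (leq_add pk ql))// addnS addSn.
Qed.

Lemma poly_space_affine X c (a : 'cV[R]_d) :
  poly_space 1 X ((fun x => c + (x *m a) ord0 ord0) \_ X).
Proof.
exists (mpoly.mpolyC d c +
    \sum_k a k ord0 *: mpoly.mpolyX R (mpoly.mnm1 k)); last first.
  congr patch; apply/funext => x; rewrite mpoly.mevalD mpoly.mevalC mxE.
  rewrite raddf_sum/=; congr (_ + _); apply: eq_bigr => k _.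
  by rewrite mpoly.mevalZ mpoly.mevalXU mulrC.
rewrite (leq_trans (mpoly.msizeD_le _ _))// geq_max.
rewrite mpoly.msizeC (leq_trans (leq_b1 _))//=.
apply: (big_ind (fun p => mpoly.msize p <= 2)%N).
- by rewrite mpoly.msize0.
- by move=> p q p2 q2; rewrite (leq_trans (mpoly.msizeD_le _ _))// geq_max p2.
- move=> k _; rewrite (leq_trans (mpoly.msizeZ_le _ _))//.
  by rewrite mpoly.msizeX mpoly.mdeg1.
Qed.

(** A monomial of degree at most one is either constant or a single variable. The induction runs
    over a list of such monomials, with the coefficients of the fixed polynomial [p]. *)
Lemma poly_space1_affine X f : poly_space 1 X f ->
  exists c (a : 'cV[R]_d), forall x, X x -> f x = c + (x *m a) ord0 ord0.
Proof.
move=> /poly_spaceP[_ [p p2 fp]].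
suff [c [a pE]] : exists c (a : 'cV[R]_d),
    forall x : 'rV_d,
      \sum_(m <- mpoly.msupp p) mpoly.mcoeff m p * \prod_i x ord0 i ^+ m i =
      c + (x *m a) ord0 ord0.
  by exists c, a => x Xx; rewrite fp// mpoly.mevalE.
have p1 : all (fun m => mpoly.mdeg m <= 1)%N (mpoly.msupp p).
  by apply/allP => m /mpoly.msize_mdeg_lt mp; rewrite -ltnS (leq_trans mp).
elim: (mpoly.msupp p) p1 => [_|m s IHs /=/andP[m1 /IHs[c [a sE]]]].
  by exists 0, 0 => x; rewrite big_nil mulmx0 mxE addr0.
set pm := mpoly.mcoeff m p.
move: m1; rewrite leq_eqVlt ltnS leqn0 mpoly.mdeg_eq1 mpoly.mdeg_eq0.
move=> /orP[/existsP[k /eqP mk]|/eqP m0].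
  exists c, (a + pm *: delta_mx k ord0) => x.
  rewrite big_cons sE -mpoly.mevalX mk mpoly.mevalXU addrCA; congr (_ + _).
  rewrite mulmxDr [RHS]mxE addrC; congr (_ + _).
  by rewrite -scalemxAr -colE !mxE /pm mk.
exists (pm + c), a => x; rewrite big_cons sE big1 ?mulr1 ?addrA// => k _.
by rewrite m0 mpoly.mnm0E expr0.
Qed.

Lemma meval_continuous p :
  continuous (fun x : 'rV[R]_d => mpoly.meval (x ord0) p).
Proof.
under eq_fun do rewrite mpoly.mevalE.
apply: continuous_big => [|m _]; first exact: add_continuous.
move=> x; apply: continuousM; [exact: cst_continuous|move: x].
apply: continuous_big => [|i _]; first exact: mul_continuous.
move=> x; apply: (@continuous_comp _ _ _ (fun x : 'rV[R]_d => x ord0 i)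
  (fun y : R => y ^+ m i)); first exact: coord_continuous.
exact: exprn_continuous.
Qed.

Lemma measurable_meval p :
  measurable_fun [set: 'rV[R]_d] (fun x => mpoly.meval (x ord0) p).
Proof.
under eq_fun do rewrite mpoly.mevalE.
apply: measurable_sum => m; apply: measurable_funM => //.
apply: measurable_prod => i _.
apply: measurable_funX; exact: (measurable_entry (T := measurableTypeR R)).
Qed.

End polynomials.

(** * Continuity, measurability and boundedness of polynomial functions *)

Section regularity.
Context {R : realType} {d : nat}.
Implicit Types (X : set 'rV[R]_d) (f : 'rV[R]_d -> R).

Lemma poly_space_continuous k X f : poly_space k X f ->
  exists2 g, continuous g & forall x, X x -> f x = g x.
Proof.
move=> /poly_spaceP[_ [p _ fp]];
  exists (fun x : 'rV_d => mpoly.meval (x ord0) p) => //.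
exact: meval_continuous.
Qed.

Lemma poly_space_measurable k X f : poly_space k X f -> measurable_fun X f.
Proof.
move=> /poly_spaceP[_ [p _ fp]].
apply: eq_measurable_fun (measurable_funTS (measurable_meval p)) => x.
by rewrite inE => /fp.
Qed.

Lemma poly_space_bounded k X f M :
  (forall x, X x -> forall i, `|x ord0 i| <= M) ->
  poly_space k X f -> exists N, forall x, X x -> `|f x| <= N.
Proof.
move=> XM /poly_space_continuous[g gc fg].
(* A cube containing X, compact as a product of segments. *)
pose box := [set x : 'rV[R]_d | forall i, `[- M, M]%classic (x ord0 i)].
have /compact_bounded/ex_strict_bound_gt0[N _ gN] : compact (g @` box).
  apply: continuous_compact; first exact: continuous_subspaceT.
  exact: (@rV_compact R d (fun=> _) (fun=> @segment_compact R (- M) M)).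
exists N => x Xx; rewrite fg// ltW//; apply: gN.
by exists x => // i; rewrite /= in_itv/= -ler_norml XM.
Qed.

End regularity.

(** * Barycentric coordinates and the geometry of the simplex *)

Section bary.
Context {R : realType} {d : nat}.
Variable v : 'I_d.+1 -> 'rV[R]_d.
Implicit Types (X : set 'rV[R]_d) (f : 'rV[R]_d -> R).

Lemma bary_affine i :
  exists c (a : 'cV[R]_d), forall x, bary v i x = c + (x *m a) ord0 ord0.
Proof.
pose B := invmx (edge_mx v).
have tE (x : 'rV_d) k :
    ((x - v ord0) *m B) ord0 k =
    - (v ord0 *m B) ord0 k + (x *m col k B) ord0 ord0.
  rewrite mulmxBl mxE [X in _ + X]mxE addrC; congr (_ + _).
  by rewrite colE mulmxA -colE [RHS]mxE.
case: (unliftP ord0 i) => [k ->|->]; rewrite /bary ?unlift_none.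
  by rewrite liftK; exists (- (v ord0 *m B) ord0 k), (col k B) => x; exact: tE.
exists (1 + \sum_k (v ord0 *m B) ord0 k), (- \sum_k col k B) => x.
rewrite mulmxN mulmx_sumr [X in _ = _ + X]mxE summxE -addrA; congr (_ + _).
by rewrite -sumrB -sumrN; apply: eq_bigr => k _; rewrite tE opprD opprK.
Qed.

Lemma poly_space_bary X i : poly_space 1 X (bary v i \_ X).
Proof.
have [c [a E]] := bary_affine i.
have -> : bary v i = fun x => c + (x *m a) ord0 ord0 by apply/funext.
exact: poly_space_affine.
Qed.

Lemma bary_continuous i : continuous (bary v i).
Proof.
have [g gc E] := poly_space_continuous (poly_space_bary setT i).
have -> // : bary v i = g by apply/funext => x; rewrite -E// patch_setT.
Qed.

Lemma measurable_bary i : measurable_fun setT (bary v i).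
Proof.
by have := poly_space_measurable (poly_space_bary setT i); rewrite patch_setT.
Qed.

Hypothesis v_nondeg : nondegenerate_simplex v.

Lemma simplexE : simplex v = [set x | forall i, 0 <= bary v i x].
Proof.
apply/seteqP; split=> x /=.
  by move=> [t [t0 t1 ->]] i; rewrite -(bary_uniq v_nondeg t1 erefl).
by move=> t; exists (bary v ^~ x); split=> //; rewrite ?bary_sum1// bary_comb.
Qed.

Lemma faceE j : face v j = simplex v `&` [set x | bary v j x = 0].
Proof.
apply/seteqP; split=> x /=.
  move=> [t [t0 tj t1 xE]]; split; first by exists t.
  by rewrite -(bary_uniq v_nondeg t1 (esym xE)).
rewrite simplexE => -[x0 xj].
by exists (bary v ^~ x); split=> //; rewrite ?bary_sum1// bary_comb.
Qed.

Lemma measurable_simplex : measurable (simplex v).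
Proof.
rewrite simplexE (_ : mkset _ = \bigcap_i [set x | 0 <= bary v i x]).
  apply: fin_bigcap_measurable => [|i _]; first exact: finite_finset.
  rewrite -[X in measurable X]setTI (_ : mkset _ = bary v i @^-1` `[0, +oo[).
    exact: (measurable_bary i).
  by apply/seteqP; split=> x /=; rewrite in_itv/= andbT.
by apply/seteqP; split=> x /= H i; [move=> _; exact: H|exact: H].
Qed.

Lemma measurable_face j : measurable (face v j).
Proof.
rewrite faceE; apply: measurableI; first exact: measurable_simplex.
rewrite -[X in measurable X]setTI.
exact: (measurable_bary j measurableT (measurable_set1 0)).
Qed.

Lemma simplex_bounded x : simplex v x ->
  forall i, `|x ord0 i| <= \sum_j \sum_k `|v j ord0 k|.
Proof.
move=> [t [t0 t1 ->]] i; rewrite summxE (le_trans (ler_norm_sum _ _ _))//.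
apply: ler_sum => j _; rewrite mxE normrM ger0_norm//.
have tj1 : t j <= 1 by rewrite -t1 (bigD1 j)//= lerDl sumr_ge0.
rewrite (bigD1 i)//= (le_trans (ler_piMl (normr_ge0 _) tj1))//.
by rewrite lerDl sumr_ge0.
Qed.

Lemma poly_space1_bary f : poly_space 1 (simplex v) f ->
  exists b, f = \sum_i b i *: (bary v i \_ (simplex v)).
Proof.
move=> f1; have [c [a fE]] := poly_space1_affine f1.
(* An affine function is the combination of the barycentric coordinates weighted by its values at
   the vertices; the constant [c] is absorbed because the coordinates sum to 1. *)
exists (fun i => c + (v i *m a) ord0 ord0); apply/funext => x; rewrite fct_sumE.
have [Sx|nSx] := pselect (simplex v x); last first.
  rewrite (poly_space_out f1)// big1// => i _.
  by rewrite -[LHS]/(_ * _) patchN ?mulr0//; apply/negP; rewrite inE.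
rewrite fE// -{1}(bary_comb x v_nondeg) mulmx_suml.
have {1}-> : c = \sum_i bary v i x * c by rewrite -mulr_suml bary_sum1 mul1r.
rewrite summxE -big_split/=.
apply: eq_bigr => i _; rewrite -[RHS]/(_ * _) patchT ?inE//.
by rewrite mulrDl mulrC -scalemxAl mxE [X in _ + X]mulrC.
Qed.

Lemma interior_simplex x : (forall i, 0 < bary v i x) -> (simplex v)° x.
Proof.
move=> x0; rewrite simplexE.
have : \forall y \near x, forall i, 0 <= bary v i y; last by [].
apply: (@filter_forall 'rV[R]_d 'I_d.+1 (fun i y => 0 <= bary v i y) _
  (@nbhs_filter _ (x : 'rV[R]_d))) => i.
have := bary_continuous (i := i) (lt_nbhsr (x0 i));
  apply: (@filterS _ _ (nbhs_filter x)) => y; exact: ltW.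
Qed.

(** Moving a point of the simplex slightly towards the centroid makes all its barycentric
    coordinates positive: they become [(1 - s) t_i + s / (d + 1)]. *)
Lemma simplex_sub_closure : simplex v `<=` closure (simplex v)°.
Proof.
move=> x [t [t0 t1 xE]] B xB.
pose y (s : R) := (1 - s) *: x + s *: (\sum_i d.+1%:R^-1 *: v i).
have yc : y @ 0^'+ --> x.
  have -> : x = y 0 by rewrite /y subr0 scale1r scale0r addr0.
  apply: cvg_at_right_filter; apply: cvgD; apply: cvgZr_tmp.
    by apply: cvgB; [exact: cvg_cst|exact: cvg_id].
  exact: cvg_id.
near (at_right (0 : R)) => s; exists (y s); split; last by near: s; exact: yc.
apply: interior_simplex => i.
have s0 : 0 < s by [].
have s1 : s < 1 by [].
have yE : \sum_i ((1 - s) * t i + s * d.+1%:R^-1) *: v i = y s.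
  rewrite /y xE !scaler_sumr -big_split/=; apply: eq_bigr => k _.
  by rewrite scalerDl !scalerA.
rewrite -(bary_uniq v_nondeg _ yE).
  by rewrite ltr_wpDl ?mulr_ge0 ?mulr_gt0 ?invr_gt0// subr_ge0 ltW.
rewrite big_split/= -mulr_sumr t1 sumr_const card_ord -mulrnAr.
by rewrite -[_^-1 *+ _]mulr_natr mulVf// !mulr1 subrK.
Unshelve. all: by end_near. Qed.

End bary.

(** Around any of its points an open set contains a ball, which for the sup norm is a box, and the
    measure of a box is the product of its positive side lengths. *)
Lemma lebesgue_rV_negligible_open (R : realType) n (U : set 'rV[R]_n) :
  open U -> (lebesgue_rV R n).-negligible U -> U = set0.
Proof.
move=> oU [B [mB B0 UB]]; apply: contrapT => /eqP/set0P[x Ux].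
have /nbhs_ballP[e /= e0 xeU] : nbhs x U by exact: open_nbhs_nbhs.
pose box := [set y : 'rV[R]_n | forall i, ball (x ord0 i) e (y ord0 i)].
have mbox : measurable box.
  rewrite (_ : box = \bigcap_i [set y | ball (x ord0 i) e (y ord0 i)]).
    apply: fin_bigcap_measurable => [|i _]; first exact: finite_finset.
    rewrite -[X in measurable X]setTI.
    exact: (measurable_entry (T := measurableTypeR R) ord0 i measurableT
      (measurable_ball _ _)).
  by apply/seteqP; split=> y /= H i; [move=> _; exact: H|exact: H].
have : (lebesgue_rV R n box <= 0)%E.
  rewrite -B0 le_measure ?inE// => y yb; apply/UB/xeU; split=> // i j.
  by rewrite ord1.
rewrite leNgt => /negP; apply;
  rewrite (lebesgue_rV_box (B := fun i => ball (x ord0 i) e)); last first.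
  by move=> i; exact: measurable_ball.
apply: (big_ind (fun z => 0 < z)%E) => [//|y z|i _]; first exact: mule_gt0.
by rewrite lebesgue_measure_ball ?ltW// lte_fin pmulrn_lgt0.
Qed.

(** * Weighted inner products: bilinearity and vanishing of the square norm *)

Section inner.
Context {R : realType} {d : nat}.
Variables (mu : {measure set 'rV[R]_d -> \bar R}) (X : set 'rV[R]_d).
Variable w : 'rV[R]_d -> R.
Implicit Types f g : 'rV[R]_d -> R.

Lemma innerC f g : inner mu X w f g = inner mu X w g f.
Proof. by apply: eq_Rintegral => x _; rewrite [f x * _]mulrC. Qed.

Lemma eq_innerl f f' g : (forall x, X x -> f x = f' x) ->
  inner mu X w f g = inner mu X w f' g.
Proof. by move=> ff'; apply: eq_Rintegral => x; rewrite inE => /ff' ->. Qed.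

(** The real-valued integral is additive on integrable functions. The product of two bounded
    measurable functions and an integrable weight is integrable, so [inner] is bilinear on this
    class. *)
Definition tame f :=
  measurable_fun X f /\ exists M, forall x, X x -> `|f x| <= M.

Lemma tame0 : tame 0.
Proof. by split; [exact: measurable_cst|exists 0 => x _; rewrite normr0]. Qed.

Lemma tameD f g : tame f -> tame g -> tame (f + g).
Proof.
move=> [mf [M fM]] [mg [N gN]]; split; first exact: measurable_funD.
exists (M + N) => x Xx; rewrite (le_trans (ler_normD _ _))//.
by rewrite lerD ?fM ?gN.
Qed.

Lemma tameZ a f : tame f -> tame (a *: f).
Proof.
move=> [mf [M fM]]; split; first exact: measurable_funM.
by exists (`|a| * M) => x Xx; rewrite normrM ler_wpM2l// fM.
Qed.

Hypothesis mX : measurable X.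
Hypothesis iw : mu.-integrable X (EFin \o w).

Lemma integrable_inner f g : tame f -> tame g ->
  mu.-integrable X (fun x => (f x * g x * w x)%:E).
Proof.
move=> [mf [M fM]] [mg [N gN]].
have bf : [bounded f x | x in X].
  by exists M; split=> [|B MB x Xx];
    rewrite ?num_real//= (le_trans (fM _ Xx))// ltW.
have bg : [bounded g x | x in X].
  by exists N; split=> [|B NB x Xx];
    rewrite ?num_real//= (le_trans (gN _ Xx))// ltW.
have := integrableMr mX mf bf (integrableMr mX mg bg iw).
by apply: eq_integrable => // x _; rewrite /= muleA -!EFinM.
Qed.

Lemma inner0l g : inner mu X w 0 g = 0.
Proof.
rewrite /inner; under eq_Rintegral do rewrite !mul0r.
by rewrite Rintegral_cst// mul0r.
Qed.

Lemma innerDl f f' g : tame f -> tame f' -> tame g ->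
  inner mu X w (f + f') g = inner mu X w f g + inner mu X w f' g.
Proof.
move=> tf tf' tg; rewrite /inner -RintegralD//; [|exact: integrable_inner..].
by apply: eq_Rintegral => x _; rewrite -!mulrDl.
Qed.

Lemma innerZl a f g : tame f -> tame g ->
  inner mu X w (a *: f) g = a * inner mu X w f g.
Proof.
move=> tf tg; rewrite /inner -RintegralZl//; last exact: integrable_inner.
by apply: eq_Rintegral => x _; rewrite !mulrA.
Qed.

Lemma inner_suml (I : finType) (c : I -> R) (f : I -> 'rV[R]_d -> R) g :
  (forall i, tame (f i)) -> tame g ->
  inner mu X w (\sum_i c i *: f i) g = \sum_i c i * inner mu X w (f i) g.
Proof.
(* Additivity needs tameness of every partial sum, so the induction carries both facts together. *)
move=> tf tg; pose K h a := tame h /\ inner mu X w h g = a.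
suff [] : K (\sum_i c i *: f i) (\sum_i c i * inner mu X w (f i) g) by [].
apply: (big_ind2 K).
- by split; [exact: tame0|exact: inner0l].
- move=> h a h' a' [th <-] [th' <-]; split; first exact: tameD.
  exact: innerDl.
- by move=> i _; split; [exact: tameZ|exact: innerZl].
Qed.

(** The integrand is nonnegative almost everywhere, so it can be replaced by its absolute value,
    whose integral vanishes only if it is zero almost everywhere. *)
Lemma inner_self_eq0 f : {ae mu, forall x, X x -> 0 <= w x} -> tame f ->
  inner mu X w f f = 0 -> {ae mu, forall x, X x -> f x ^+ 2 * w x = 0}.
Proof.
move=> w0 tf ff0; have iff := integrable_inner tf tf.
have mff := measurable_int _ iff.
have eqabs : ae_eq mu X (fun x => `|(f x * f x * w x)%:E|%E)
    (fun x => (f x * f x * w x)%:E).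
  apply: filterS w0 => x wx Xx; rewrite abse_EFin ger0_norm//.
  by rewrite mulr_ge0 ?wx// -expr2 sqr_ge0.
have : ae_eq mu X (fun x => (f x * f x * w x)%:E) (cst 0%E).
  apply/(ae_eq_integral_abs mu mX mff).
  transitivity (\int[mu]_(x in X) (f x * f x * w x)%:E)%E.
    by apply: ae_eq_integral => //; exact: measurableT_comp.
  by rewrite -[LHS]fineK ?integrable_fin_num// [fine _]ff0.
by apply: filterS => x xf /xf; rewrite -expr2 => -[].
Qed.

End inner.

Lemma tame_subset (R : realType) d (X Y : set 'rV[R]_d) f :
  measurable Y -> X `<=` Y -> tame Y f -> tame X f.
Proof.
move=> mY XY [mf [M fM]]; split; first exact: measurable_funS mf.
by exists M => x /XY; exact: fM.
Qed.

(** * Products of barycentric coordinates and their values at vertices and midpoints *)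

Section simplex_basis.
Context {R : realType} {d : nat}.
Variable v : 'I_d.+1 -> 'rV[R]_d.
Hypothesis v_nondeg : nondegenerate_simplex v.
Implicit Types (f : 'rV[R]_d -> R).

Local Notation S := (simplex v).
Local Notation lambda i := (bary v i \_ S).

Lemma poly_space_tame k f : poly_space k S f -> tame S f.
Proof.
move=> fk; split; first exact: poly_space_measurable fk.
exact: poly_space_bounded (@simplex_bounded _ _ v) fk.
Qed.

(** A singleton gives a vertex and a pair the midpoint of an edge. For the empty set all weights are
    0, hence the nonemptiness conditions below. *)
Definition face_center (A : {set 'I_d.+1}) : 'rV[R]_d :=
  \sum_i ((i \in A)%:R / #|A|%:R) *: v i.

Lemma face_center_weights (A : {set 'I_d.+1}) : A != finset.set0 ->
  \sum_i ((i \in A)%:R / #|A|%:R) = 1 :> R.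
Proof.
move=> A0; rewrite -mulr_suml (_ : \sum_i _ = #|A|%:R).
  by rewrite divff// pnatr_eq0 -lt0n card_gt0.
by rewrite -natr_sum -sum1_card [in RHS]big_mkcond; congr _%:R.
Qed.

Lemma simplex_face_center A : A != finset.set0 -> S (face_center A).
Proof.
move=> A0; exists (fun i => (i \in A)%:R / #|A|%:R).
by split=> //; exact: face_center_weights.
Qed.

Lemma bary_face_center A i : A != finset.set0 ->
  bary v i (face_center A) = (i \in A)%:R / #|A|%:R.
Proof.
by move=> /face_center_weights A1; rewrite -(bary_uniq v_nondeg A1 erefl).
Qed.

Lemma bary_vertex i j : bary v i (face_center [set j]%SET) = (i == j)%:R.
Proof. by rewrite bary_face_center ?inE ?cards1 ?divr1// -card_gt0 cards1. Qed.

(** If [A] differs from [B], the bound on cardinals leaves some index of [B] outside [A], and its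
    coordinate vanishes at the center of [A]. If they agree, each factor is the inverse of the
    cardinal. *)
Lemma prod_bary_face_center (A B : {set 'I_d.+1}) : (0 < #|A| <= #|B|)%N ->
  \prod_(i in B) bary v i (face_center A) = (A == B)%:R / #|B|%:R ^+ #|B|.
Proof.
move=> /andP[A0 AB]; have {}A0 : A != finset.set0 by rewrite -card_gt0.
have [eAB|neAB] := eqVneq A B.
  rewrite (eq_bigr (fun=> #|B|%:R^-1)) => [|i iB].
    by rewrite prodr_const mul1r exprVn.
  by rewrite bary_face_center// eAB iB mul1r.
have [i iB iA] : exists2 i, i \in B & i \notin A.
  by apply/subsetPn; apply: contraNN neAB => BA; rewrite eq_sym eqEcard BA.
by rewrite (bigD1 i)//= bary_face_center// (negbTE iA) !mul0r.
Qed.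

Lemma patch_face_center f A : A != finset.set0 ->
  (f \_ S) (face_center A) = f (face_center A).
Proof. by move=> A0; rewrite patchT// inE; exact: simplex_face_center. Qed.

Lemma bary_comb_vertex (b : 'I_d.+1 -> R) j :
  (\sum_i b i *: lambda i) (face_center [set j]%SET) = b j.
Proof.
rewrite fct_sumE (bigD1 j)//= big1 => [|i ij].
  by rewrite -[X in X + _]/(_ * _) patch_face_center -?card_gt0 ?cards1//
    bary_vertex eqxx mulr1 addr0.
by rewrite -[LHS]/(_ * _) patch_face_center -?card_gt0 ?cards1// bary_vertex
  (negbTE ij) mulr0.
Qed.

Lemma bary_lin_indep : lin_indep (fun i => lambda i).
Proof. by move=> b b0 j; rewrite -(bary_comb_vertex b j) b0. Qed.

(** Two-element sets index the products lambda_i lambda_j with i < j without ordering the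
    factors. *)
Definition bary_prod (A : {set 'I_d.+1}) : 'rV[R]_d -> R :=
  (fun x => \prod_(i in A) bary v i x) \_ S.

Lemma bary_prod_poly (A : {set 'I_d.+1}) :
  #|A| = 2 -> poly_space 2 S (bary_prod A).
Proof.
move=> /eqP/cards2P[i [j [ij ->]]].
have := poly_spaceM (poly_space_bary v S i) (poly_space_bary v S j).
congr (poly_space 2 S _); apply/funext => x; rewrite /bary_prod /patch.
by case: ifP => _; rewrite ?mulr0// big_setU1 ?inE//= big_set1.
Qed.

(** Each product vanishes at the vertices. If their combination is affine, its vertex values are its
    barycentric coefficients, so it is zero, and midpoints then isolate the [c k]. *)
Lemma bary_prod_indep_mod1 (I : finType) (A : I -> {set 'I_d.+1}) (c : I -> R) :
  injective A -> (forall k, #|A k| = 2) ->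
  poly_space 1 S (\sum_k c k *: bary_prod (A k)) -> forall k, c k = 0.
Proof.
move=> A_inj A2 f1 k; set f := \sum_k _ in f1.
have fE (B : {set 'I_d.+1}) : (0 < #|B| <= 2)%N ->
    f (face_center B) = \sum_l c l * ((B == A l)%:R / 2 ^+ 2).
  move=> B2; have B0 : B != finset.set0 by rewrite -card_gt0; case/andP: B2.
  rewrite /f fct_sumE; apply: eq_bigr => l _.
  by rewrite -[LHS]/(_ * _) /bary_prod patch_face_center// prod_bary_face_center
    A2.
have [b fb] := poly_space1_bary v_nondeg f1.
have b0 j : b j = 0.
  rewrite -(bary_comb_vertex b j) -fb fE ?cards1// big1// => l _.
  have [jA|_] := eqVneq; last by rewrite mul0r mulr0.
  by have := A2 l; rewrite -jA cards1.
have f0 : f = 0 by rewrite fb big1// => i _; rewrite b0 scale0r.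
(* At the midpoint of the edge [A k] only the product indexed by [k] survives, with value 1/4. *)
have := fE (A k); rewrite A2 f0 => /(_ isT)/esym.
rewrite (bigD1 k)//= big1 => [|l lk].
  by rewrite eqxx addr0 mul1r => /eqP;
    rewrite mulf_eq0 invr_eq0 expf_eq0/= pnatr_eq0 orbF => /eqP.
by rewrite (inj_eq A_inj) eq_sym (negbTE lk) mul0r mulr0.
Qed.

End simplex_basis.

(** Since [(d + 1) d = (d - 2)(d + 1) + 2 (d + 1)] and the last term is even, the integer halves add
    up without a carry. *)
Lemma dtildeD d : (2 <= d)%N -> (dtilde d + d.+1)%N = 'C(d.+1, 2).
Proof.
case: d => [//|[//|k]] _; rewrite bin2 /dtilde !subSS subn0.
have -> : (k.+3 * k.+3.-1 = k * k.+3 + k.+3.*2)%N.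
  by rewrite -muln2 [(k * _)%N]mulnC -mulnDr addn2.
by rewrite halfD odd_double andbF add0n doubleK.
Qed.

(** * Definiteness, projection onto P_1, and the dimension count for S_2 *)

Section orthogonal_decomposition.
Context {R : realType} {d : nat}.
Variable v : 'I_d.+1 -> 'rV[R]_d.
Hypothesis v_nondeg : nondegenerate_simplex v.
Variable Omega : 'rV[R]_d -> R.
Hypothesis Omega_density : prob_density (lebesgue_rV R d) (simplex v) Omega.
Hypothesis Omega_gt0 :
  {ae lebesgue_rV R d, forall x, (simplex v)° x -> 0 < Omega x}.
Implicit Types (f : 'rV[R]_d -> R).

Local Notation S := (simplex v).
Local Notation lambda i := (bary v i \_ S).
Local Notation "<< f , g >>" := (inner (lebesgue_rV R d) S Omega f g).
Local Notation S2 := (orth_quadratics (lebesgue_rV R d) S Omega).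

Let mS : measurable S := measurable_simplex v_nondeg.

Let iOmega : (lebesgue_rV R d).-integrable S (EFin \o Omega).
Proof. by case: Omega_density. Qed.

(** Positivity of [Omega] makes [f] vanish almost everywhere in the interior, continuity makes it
    vanish everywhere there, and density of the interior extends this to the simplex. *)
Lemma inner_definite k f : poly_space k S f -> << f, f >> = 0 -> f = 0.
Proof.
move=> fk ff0; have [g gc fg] := poly_space_continuous fk.
have fOmega0 : {ae lebesgue_rV R d, forall x, S x -> f x ^+ 2 * Omega x = 0}.
  apply: inner_self_eq0 => //; first by case: Omega_density.
  exact: poly_space_tame fk.
(* [g] is continuous on the whole space, whereas [f] is cut off outside the simplex; this makes [U]
   open. *)
pose U := (S)° `&` [set x | g x != 0].
have U0 : U = set0.
  apply: lebesgue_rV_negligible_open.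
    apply: openI; first exact: open_interior.
    rewrite (_ : mkset _ = g @^-1` [set y | y != 0]) //.
    by apply: open_comp; [move=> x _; exact: gc|exact: open_neq].
  have [N [mN N0 NU]] : {ae lebesgue_rV R d, forall x, (S)° x -> g x = 0}.
    apply: filterS2 fOmega0 Omega_gt0 => x f0 O0 Sx.
    have SSx : S x := interior_subset Sx.
    have /eqP := f0 SSx; rewrite mulf_eq0 (gt_eqF (O0 Sx)) orbF expf_eq0/= =>
      /eqP.
    by rewrite fg.
  exists N; split=> // x [Sx /eqP gx]; apply: NU => /=; apply/not_implyP.
  by split.
apply/funext => x; have [Sx|/(poly_space_out fk)//] := pselect (S x).
rewrite fg//; apply: contrapT => /eqP gx.
have nbg : nbhs x [set y | g y != 0].
  have : nbhs (g x) [set y | y != 0] by apply: open_nbhs_nbhs; split=> //;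
    exact: open_neq.
  by move=> /(gc x).
have [y [Sy gy]] := simplex_sub_closure v_nondeg Sx nbg.
by suff : set0 y by []; rewrite -U0.
Qed.

(** A kernel vector gives a combination orthogonal to every [f i], hence to itself; it is zero by
    definiteness, and so are its coefficients by independence. *)
Lemma gram_unitmx m (f : 'I_m -> 'rV[R]_d -> R) k :
  (forall i, poly_space k S (f i)) -> lin_indep f ->
  \matrix_(i, j) << f j, f i >> \in unitmx.
Proof.
move=> fk f_indep; apply/unitmx_ker0 => c Gc0; apply/colP => i; rewrite mxE.
apply: (f_indep (fun i => c i ord0)).
have tf j := poly_space_tame (fk j).
have tg : tame S (\sum_i c i ord0 *: f i).
  exact: poly_space_tame (poly_space_sum _ fk).
apply: (@inner_definite k); first exact: poly_space_sum.
rewrite inner_suml// big1// => j _; rewrite innerC inner_suml//.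
have /colP/(_ j) := Gc0; rewrite !mxE => Gcj.
rewrite [X in _ * X](_ : _ = 0) ?mulr0// -[RHS]Gcj.
by apply: eq_bigr => l _; rewrite mxE mulrC.
Qed.

Lemma orthogonal_part f : poly_space 2 S f ->
  exists b, S2 (f - \sum_i b i *: lambda i).
Proof.
move=> f2; pose lam i := lambda i.
have lam1 i : poly_space 1 S (lam i) by exact: poly_space_bary.
have tlam i := poly_space_tame (lam1 i).
have Nu := gram_unitmx lam1 (bary_lin_indep v_nondeg).
set N := (X in X \in unitmx) in Nu.
(* Solution of the normal equations of the orthogonal projection of [f] onto P_1. *)
pose b := invmx N *m \col_j << f, lam j >>.
exists (fun i => b i ord0); pose l := \sum_i b i ord0 *: lam i.
have l1 : poly_space 1 S l by exact: poly_space_sum.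
have l2 := poly_space_le (leqnSn 1) l1.
have tf := poly_space_tame f2; have tl := poly_space_tame l1.
rewrite -[X in S2 (f - X)]/l -scaleN1r.
split; first by apply: poly_spaceD => //; exact: poly_spaceZ.
move=> phi /(poly_space1_bary v_nondeg)[e ->]; rewrite innerC inner_suml//;
  last first.
  by apply: tameD => //; exact: tameZ.
rewrite big1// => i _; rewrite innerC -/(lam i) innerDl// ?innerZl//;
  last exact: tameZ.
rewrite mulN1r inner_suml//.
have /colP/(_ i) : N *m b = \col_j << f, lam j >> by rewrite mulKVmx.
rewrite [LHS]mxE [RHS]mxE => <-; rewrite -sumrB big1 ?mulr0// => j _.
by rewrite [N _ _]mxE [X in X - _]mulrC subrr.
Qed.

(** The residuals [u] of the pair products after projection onto P_1 are independent elements of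
    S_2. They are as many as the [rho] and [psi] together, which span S_2 and are therefore
    independent. *)
Lemma direct_sum_lin_indep m n (rho : 'I_m -> 'rV[R]_d -> R)
    (psi : 'I_n -> 'rV[R]_d -> R) :
  (m + n = 'C(d.+1, 2))%N ->
  direct_sum S2 (lin_span rho) (lin_span psi) ->
  forall a c, \sum_l a l *: rho l + \sum_i c i *: psi i = 0 ->
    (forall l, a l = 0) /\ (forall i, c i = 0).
Proof.
move=> mn [S2E _] a c ac0.
(* Concatenation of two families, polymorphic so as to serve for both functions and coefficients. *)
pose cat T (a : 'I_m -> T) (c : 'I_n -> T) (i : 'I_(m + n)) : T :=
  match fintype.split i with inl l => a l | inr j => c j end.
have sumE a' c' : \sum_i cat _ a' c' i *: cat _ rho psi i =
    \sum_l a' l *: rho l + \sum_i c' i *: psi i.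
  rewrite big_split_ord/=; congr (_ + _); apply: eq_bigr => i _.
    by rewrite /cat (unsplitK (inl _ i)).
  by rewrite /cat (unsplitK (inr _ i)).
pose P := [set A : {set 'I_d.+1} | #|A| == 2]%SET.
have PE : (m + n)%N = #|P| by rewrite mn card_draws card_ord.
pose A (k : 'I_(m + n)) : {set 'I_d.+1} := enum_val (cast_ord PE k).
have A2 k : #|A k| = 2 by have := enum_valP (cast_ord PE k);
  rewrite inE => /eqP.
have A_inj : injective A by apply: inj_comp;
  [exact: enum_val_inj|exact: cast_ord_inj].
have [b uS2] := choice (fun k => orthogonal_part (bary_prod_poly v (A2 k))).
pose u k := bary_prod v (A k) - \sum_i b k i *: lambda i.
have u_indep : lin_indep u.
  (* A relation between the residuals says that the same combination of the products lies in P_1. *)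
  move=> e ue0; apply: (bary_prod_indep_mod1 v_nondeg A_inj A2).
  rewrite (_ : \sum_k _ = \sum_k e k *: (\sum_i b k i *: lambda i)).
    by apply: poly_space_sum => k; apply: poly_space_sum => i;
      exact: poly_space_bary.
  apply/eqP; rewrite -subr_eq0 -sumrB -[X in _ == X]ue0.
  by apply/eqP/eq_bigr => k _; rewrite scalerBr.
have w_indep : lin_indep (cat _ rho psi).
  apply: (lin_indep_of_span u_indep) => k.
  have := uS2 k; rewrite -/(u k) S2E => -[_ [a' ->] [_ [c' ->] <-]].
  by exists (cat _ a' c'); rewrite sumE.
have ac := w_indep _ (etrans (sumE a c) ac0).
split=> i; first by have := ac (lshift n i); rewrite /cat (unsplitK (inl _ i)).
by have := ac (rshift m i); rewrite /cat (unsplitK (inr _ i)).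
Qed.

End orthogonal_decomposition.

(** * The block system of the functionals in the basis (lambda, rho, psi) *)

Theorem theorem1 (R : realType) (d : nat) (d_ge2 : (2 <= d)%N)
    (v : 'I_d.+1 -> 'rV[R]_d) (v_nondeg : nondegenerate_simplex v)
    (Omega : 'rV[R]_d -> R)
    (Omega_density : prob_density (lebesgue_rV R d) (simplex v) Omega)
    (Omega_gt0 : {ae lebesgue_rV R d, forall x, (simplex v)° x -> 0 < Omega x})
    (omega : 'I_d.+1 -> 'rV[R]_d -> R)
    (omega_density : forall j,
       prob_density (face_measure v j) (face v j) (omega j))
    (omega_gt0 : forall j,
       {ae face_measure v j, forall x, face v j x -> 0 < omega j x})
    (omega_trace : forall j, conditional_trace v Omega j (omega j))
    (rho : 'I_(dtilde d) -> 'rV[R]_d -> R)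
    (rho_orth : forall k,
       orth_quadratics (lebesgue_rV R d) (simplex v) Omega (rho k))
    (rho_indep : lin_indep rho)
    (psi : 'I_d.+1 -> 'rV[R]_d -> R)
    (psi_orth : forall i,
       orth_quadratics (lebesgue_rV R d) (simplex v) Omega (psi i))
    (rho_psi : direct_sum
       (orth_quadratics (lebesgue_rV R d) (simplex v) Omega)
       (lin_span rho) (lin_span psi))
    (q : 'I_d.+1 -> 'rV[R]_d -> R)
    (q_orth : forall j,
       orth_quadratics (face_measure v j) (face v j) (omega j) (q j)) :
  let I_ j f := inner (face_measure v j) (face v j) (omega j) f (fun=> 1) in
  let L_ j f := inner (face_measure v j) (face v j) (omega j) f (q j) in
  let V_ k f := inner (lebesgue_rV R d) (simplex v) Omega f (rho k) in
  let A := \matrix_(j < d.+1, i < d.+1) I_ j (bary v i) in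
  let G := \matrix_(k < dtilde d, l < dtilde d) V_ k (rho l) in
  let C := \matrix_(k < dtilde d, i < d.+1) V_ k (psi i) in
  let Ct := \matrix_(j < d.+1, l < dtilde d) L_ j (rho l) in
  let M := \matrix_(j < d.+1, i < d.+1) L_ j (psi i) in
  unisolvent (poly_space 2 (simplex v)) (range I_ `|` range L_ `|` range V_) <->
  A \in unitmx /\ M - Ct *m invmx G *m C \in unitmx.
Proof.
move=> I_ L_ V_ A G C Ct M.
have mS := measurable_simplex v_nondeg.
have mF j := measurable_face v_nondeg j.
have iOmega : (lebesgue_rV R d).-integrable (simplex v) (EFin \o Omega).
  by case: Omega_density.
have iomega j : (face_measure v j).-integrable (face v j) (EFin \o omega j).
  by case: (omega_density j).
have FS j : face v j `<=` simplex v by rewrite faceE//; exact: subIsetl.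
(* [A] is built from the uncut coordinates, which agree with these on every face. *)
pose lam i := bary v i \_ (simplex v).
have lam1 i : poly_space 1 (simplex v) (lam i) by exact: poly_space_bary.
have lam2 i := poly_space_le (leqnSn 1) (lam1 i).
have rho2 k : poly_space 2 (simplex v) (rho k) by case: (rho_orth k).
have psi2 i : poly_space 2 (simplex v) (psi i) by case: (psi_orth i).
pose quad (b c : 'cV[R]_d.+1) (a : 'cV[R]_(dtilde d)) : 'rV[R]_d -> R :=
  \sum_i b i ord0 *: lam i + \sum_l a l ord0 *: rho l +
  \sum_i c i ord0 *: psi i.
have quad_poly b c a : poly_space 2 (simplex v) (quad b c a).
  by do 2?[apply: poly_spaceD]; apply: poly_space_sum.
(* Projection onto P_1 leaves a residual in S_2, which then splits along V and W. *)
have quad_ex p : poly_space 2 (simplex v) p -> exists b c a, p = quad b c a.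
  move=> /(orthogonal_part v_nondeg Omega_density Omega_gt0)[b].
  rewrite rho_psi.1 => -[_ [a ->] [_ [c ->] /eqP]].
  rewrite eq_sym subr_eq => /eqP ->.
  exists (\col_i b i), (\col_i c i), (\col_l a l); rewrite /quad addrC addrA.
  by congr (_ + _ + _); apply: eq_bigr => i _; rewrite mxE.
have quad_inj b c a : quad b c a = 0 -> [/\ b = 0, a = 0 & c = 0].
  (* The part [s] in S_2 equals [- l], hence lies in P_1 as well: it is orthogonal to itself and
     vanishes. *)
  rewrite /quad -addrA; set l := \sum_i _; set s := (X in l + X) => ls0.
  have sl : s = -1 *: l by apply: (addrI l); rewrite scaleN1r subrr.
  have s1 : poly_space 1 (simplex v) s.
    by rewrite sl; apply: poly_spaceZ; exact: poly_space_sum.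
  have s_orth : orth_quadratics (lebesgue_rV R d) (simplex v) Omega s.
    rewrite rho_psi.1; exists (\sum_l a l ord0 *: rho l); first by eexists.
    by exists (\sum_i c i ord0 *: psi i); first by eexists.
  have s0 : s = 0.
    by apply: (inner_definite v_nondeg Omega_density Omega_gt0 s1);
      exact: s_orth.2.
  have l0 : l = 0 by rewrite -ls0 s0 addr0.
  have [a0 c0] := direct_sum_lin_indep v_nondeg Omega_density Omega_gt0
    (dtildeD d_ge2) rho_psi s0.
  by split; apply/colP => i; rewrite mxE//; exact: (bary_lin_indep v_nondeg l0).
have inner_quad (mu : {measure set 'rV[R]_d -> \bar R}) X w g :
    measurable X -> X `<=` simplex v -> mu.-integrable X (EFin \o w) ->
    tame X g -> forall b c a, inner mu X w (quad b c a) g =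
    \sum_i b i ord0 * inner mu X w (lam i) g +
    \sum_l a l ord0 * inner mu X w (rho l) g +
    \sum_i c i ord0 * inner mu X w (psi i) g.
  move=> mX XS iw tg b c a.
  have tX f : poly_space 2 (simplex v) f -> tame X f.
    move=> f2; exact: tame_subset mS XS (poly_space_tame f2).
  by rewrite !innerDl ?inner_suml// => *; apply: tX => //;
    try apply: poly_spaceD; apply: poly_space_sum.
have I_quad b c a : \col_j I_ j (quad b c a) =
    A *m b + (\matrix_(j, l) I_ j (rho l)) *m a +
    (\matrix_(j, i) I_ j (psi i)) *m c.
  apply/colP => j; rewrite !mxE /I_.
  rewrite (inner_quad _ _ _ _ (mF j) (FS j) (iomega j))//; last first.
    by split; [exact: measurable_cst|exists 1 => x _; rewrite normr1].
  congr (_ + _ + _); apply: eq_bigr => i _; rewrite mxE mulrC//; congr (_ * _).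
  by apply: eq_innerl => x /FS Sx; rewrite /lam patchT// inE.
have L_quad b c a : \col_j L_ j (quad b c a) = Ct *m a + M *m c.
  apply/colP => j; rewrite !mxE /L_.
  rewrite (inner_quad _ _ _ _ (mF j) (FS j) (iomega j))//; last first.
    have [q2 _] := q_orth j; split; first exact: poly_space_measurable q2.
    by apply: poly_space_bounded q2 => x /FS; exact: simplex_bounded.
  rewrite big1 ?add0r => [|i _].
    by congr (_ + _); apply: eq_bigr => i _; rewrite mxE mulrC.
  (* [q j] is orthogonal to elements of P_1 of the face, which are cut off outside the face, so the
     coordinate has to be cut off there too. *)
  rewrite (@eq_innerl _ _ _ _ _ _ (bary v i \_ (face v j))) => [|x Fx].
    by rewrite innerC ((q_orth j).2 _ (poly_space_bary v _ i)) mulr0.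
  by have Sx := FS _ _ Fx; rewrite /lam !patchT ?inE.
have V_quad b c a : \col_k V_ k (quad b c a) = G *m a + C *m c.
  apply/colP => k; rewrite !mxE /V_ inner_quad//; last exact: poly_space_tame.
  rewrite big1 ?add0r => [|i _].
    by congr (_ + _); apply: eq_bigr => i _; rewrite mxE mulrC.
  by rewrite innerC (rho_orth k).2 ?mulr0.
have Gu : G \in unitmx.
  by apply: (gram_unitmx v_nondeg Omega_density Omega_gt0 rho2).
(* Through the coordinates of [quad], unisolvence becomes triviality of the kernel of the block
   system. *)
rewrite -(block_triangular_ker0 A (\matrix_(j, i) I_ j (psi i)) M
  (\matrix_(j, l) I_ j (rho l)) Ct C Gu); split=> [uni b c a Ib La Va|ker0 p].
  apply: quad_inj; apply: uni => // l [[|]|] [j _ <-].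
  - by move/colP/(_ j): Ib; rewrite -I_quad !mxE.
  - by move/colP/(_ j): La; rewrite -(L_quad b) !mxE.
  - by move/colP/(_ j): Va; rewrite -(V_quad b) !mxE.
move=> /quad_ex[b [c [a ->]]] p0.
have [|||-> -> ->] := ker0 b c a.
- by rewrite -I_quad; apply/colP => j; rewrite !mxE p0//; left; left; exists j.
- by rewrite -(L_quad b); apply/colP => j; rewrite !mxE p0//; left; right;
  exists j.
- by rewrite -(V_quad b); apply/colP => j; rewrite !mxE p0//; right; exists j.
by rewrite /quad !big1 ?addr0// => i _; rewrite mxE scale0r.
Qed.
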